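(* Under the canonical isomorphism of iterated fiber products of groupoids, the horizontal composition functor $\circ$ is associative. Explicitly, let $\mathsf G,\mathsf H,\mathsf N,\mathsf M$ be groupoids. For morphisms $\mathsf A=(\psi,\mathsf I,\mathsf u):\mathsf G\rightharpoonup\mathsf H$, $\mathsf B=(\phi,\mathsf J,\mathsf v):\mathsf H\rightharpoonup\mathsf N$, $\mathsf C=(\varphi,\mathsf K,\mathsf w):\mathsf N\rightharpoonup\mathsf M$, the canonical isomorphism $(\mathsf I\times_{\mathsf H}\mathsf J)\times_{\mathsf N}\mathsf K\cong\mathsf I\times_{\mathsf H}(\mathsf J\times_{\mathsf N}\mathsf K)$ identifies $\mathsf C\circ(\mathsf B\circ\mathsf A)$ with $(\mathsf C\circ\mathsf B)\circ\mathsf A$; and for arrows $\alpha_1\in\mathrm{Mor}^1(\mathsf G,\mathsf H)$, $\alpha_2\in\mathrm{Mor}^1(\mathsf H,\mathsf N)$, $\alpha_3\in\mathrm{Mor}^1(\mathsf N,\mathsf M)$, the arrows $(\alpha_3\circ\alpha_2)\circ\alpha_1$ and $\alpha_3\circ(\alpha_2\circ\alpha_1)$ coincide under the identifications of their sources and targets given by these canonical isomorphisms.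
   Context: A groupoid $\mathsf G=(G^1\rightrightarrows G^0)$ is a small category all of whose arrows are invertible; $G^1(a,b)$ is the set of arrows from $a$ to $b$. Composition is written from left to right: for $x\in G^1(a,b)$, $y\in G^1(b,c)$ one has $x\cdot y\in G^1(a,c)$. A strict morphism $\mathsf f=(f^0,f^1):\mathsf G\to\mathsf H$ is a functor. A natural transformation $\alpha:\mathsf f\Rightarrow\mathsf g$ is a map $\alpha:G^0\to H^1$ with $\alpha(a)\in H^1(f^0(a),g^0(a))$ and $f^1(x)\cdot\alpha(b)=\alpha(a)\cdot g^1(x)$ for $x\in G^1(a,b)$. A strict morphism $\mathsf f:\mathsf G\to\mathsf H$ is an equivalence if (1) every object of $H^0$ is the target of an arrow whose source lies in $f^0(G^0)$, and (2) $f^1:G^1(a,b)\to H^1(f^0(a),f^0(b))$ is bijective for all $a,b\in G^0$. Fiber product: for strict morphisms $\mathsf f:\mathsf F\to\mathsf H$, $\mathsf g:\mathsf G\to\mathsf H$, the groupoid $\mathsf F\times_{\mathsf H}\mathsf G$ has objects the triples $(a,x,b)$ with $a\in F^0$, $b\in G^0$, $x\in H^1(f^0(a),g^0(b))$; an arrow $(a,x,b)\to(a',x',b')$ is a pair $(y,z)$ with $y\in F^1(a,a')$, $z\in G^1(b,b')$ and $x\cdot g^1(z)=f^1(y)\cdot x'$. $\pi_1,\pi_2$ are the projections. Given strict morphisms $\mathsf I\to\mathsf H\leftarrow\mathsf J\to\mathsf N\leftarrow\mathsf K$, the canonical isomorphism $(\mathsf I\times_{\mathsf H}\mathsf J)\times_{\mathsf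 N}\mathsf K\cong\mathsf I\times_{\mathsf H}(\mathsf J\times_{\mathsf N}\mathsf K)$ is $((i,x,j),y,k)\leftrightarrow(i,x,(j,y,k))$ on objects, and the analogous rebracketing on arrows. $\mathsf{Mor}(\mathsf G,\mathsf H)=(\mathrm{Mor}^1(\mathsf G,\mathsf H)\rightrightarrows\mathrm{Mor}^0(\mathsf G,\mathsf H))$ is the groupoid whose objects are morphisms $(\psi,\mathsf K,\mathsf u):\mathsf G\rightharpoonup\mathsf H$, i.e. pairs of strict morphisms $\mathsf G\xleftarrow{\psi}\mathsf K\xrightarrow{\mathsf u}\mathsf H$ with $\psi$ an equivalence; an arrow $(\psi_1,\mathsf K_1,\mathsf u_1)\to(\psi_2,\mathsf K_2,\mathsf u_2)$ is a natural transformation $\mathsf u_1\circ\pi_1\Rightarrow\mathsf u_2\circ\pi_2:\mathsf K_1\times_{\mathsf G}\mathsf K_2\to\mathsf H$. Composition of morphisms: for $(\psi,\mathsf K,\mathsf u):\mathsf G\rightharpoonup\mathsf H$ and $(\phi,\mathsf L,\mathsf v):\mathsf H\rightharpoonup\mathsf N$, $(\phi,\mathsf L,\mathsf v)\circ(\psi,\mathsf K,\mathsf u):=(\psi\circ\pi_1,\ \mathsf K\times_{\mathsf H}\mathsf L,\ \mathsf v\circ\pi_2):\mathsf G\rightharpoonup\mathsf N$, the fiber product being over $\mathsf u$ and $\phi$. Horizontal composition of arrows: for $\alpha:(\psi_1,\mathsf K_1,\mathsf u_1)\to(\psi_2,\mathsf K_2,\mathsf u_2)$ in $\mathsf{Mor}(\mathsf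 G,\mathsf H)$ and $\beta:(\phi_1,\mathsf J_1,\mathsf v_1)\to(\phi_2,\mathsf J_2,\mathsf v_2)$ in $\mathsf{Mor}(\mathsf H,\mathsf N)$, write an object of $(\mathsf K_1\times_{\mathsf H}\mathsf J_1)\times_{\mathsf G}(\mathsf K_2\times_{\mathsf H}\mathsf J_2)$ as $(j_1,x,k_1,z,k_2,y,j_2)$, where $x:u_1^0(k_1)\to\phi_1^0(j_1)$ and $y:u_2^0(k_2)\to\phi_2^0(j_2)$ in $H^1$ and $z:\psi_1^0(k_1)\to\psi_2^0(k_2)$ in $G^1$. Then $(\beta\circ\alpha)(j_1,x,k_1,z,k_2,y,j_2):=\beta(j_1,\ x^{-1}\cdot\alpha(k_1,z,k_2)\cdot y,\ j_2)$. *)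

(* Defs.v *)
From mathcomp Require Import ssreflect ssrfun ssrbool.
From Stdlib Require Import ProofIrrelevance.

Set Implicit Arguments.
Unset Strict Implicit.
Unset Printing Implicit Defensive.
(* Records get definitional eta, so that the rebracketing functors below are
   mutually inverse and commute with the legs up to conversion on objects. *)
Set Primitive Projections.

Declare Scope groupoid_scope.
Delimit Scope groupoid_scope with gpd.
Local Open Scope groupoid_scope.

Record groupoid := Groupoid {
  ob :> Type;
  arr : ob -> ob -> Type;
  gid : forall a, arr a a;
  gcomp : forall a b c, arr a b -> arr b c -> arr a c;
  ginv : forall a b, arr a b -> arr b a;
  gcompA : forall a b c d (x : arr a b) (y : arr b c) (z : arr c d),
    gcomp x (gcomp y z) = gcomp (gcomp x y) z;
  gcomp1l : forall a b (x : arr a b), gcomp (gid a) x = x;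
  gcomp1r : forall a b (x : arr a b), gcomp x (gid b) = x;
  gcompVl : forall a b (x : arr a b), gcomp (ginv x) x = gid b;
  gcompVr : forall a b (x : arr a b), gcomp x (ginv x) = gid a
}.

Arguments arr {g} a b.
Arguments gid {g} a.
Arguments gcomp {g a b c} x y.
Arguments ginv {g a b} x.

(* Composition is written from left to right. *)
Notation "x · y" := (gcomp x y) (at level 40, left associativity)
  : groupoid_scope.
Notation "x ^-1" := (ginv x) : groupoid_scope.

Record functor (G H : groupoid) := Functor {
  fob :> G -> H;
  fmap : forall a b : G, arr a b -> arr (fob a) (fob b);
  fmap1 : forall a, fmap (gid a) = gid (fob a);
  fmapM : forall a b c (x : arr a b) (y : arr b c),
    fmap (x · y) = fmap x · fmap y
}.

Arguments fmap {G H} f {a b} x : rename.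

Definition functor_id (G : groupoid) : functor G G :=
  @Functor G G (fun a => a) (fun _ _ x => x)
    (fun a => erefl) (fun _ _ _ x y => erefl).

Section FunctorComp.
Variables (G H N : groupoid) (g : functor H N) (f : functor G H).

Fact functor_comp1 a : fmap g (fmap f (gid a)) = gid (g (f a)).
Proof. by rewrite !fmap1. Qed.

Fact functor_compM a b c (x : arr a b) (y : arr b c) :
  fmap g (fmap f (x · y)) = fmap g (fmap f x) · fmap g (fmap f y).
Proof. by rewrite !fmapM. Qed.

Definition functor_comp : functor G N :=
  @Functor G N (fun a => g (f a)) (fun _ _ x => fmap g (fmap f x))
    functor_comp1 functor_compM.

End FunctorComp.

Notation "g ∘ f" := (functor_comp g f) (at level 40, left associativity)
  : groupoid_scope.

Record nat_trans (G H : groupoid) (f g : functor G H) := NatTrans {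
  ntc :> forall a : G, arr (f a) (g a);
  ntcP : forall (a b : G) (x : arr a b), fmap f x · ntc b = ntc a · fmap g x
}.

Definition equivalence (G H : groupoid) (f : functor G H) : Prop :=
  (forall c : H, exists a : G, inhabited (arr (f a) c)) /\
  (forall a b : G, bijective (fun x : arr a b => fmap f x)).

Section GroupoidTheory.
Variable G : groupoid.

Lemma gcompKV (a b c : G) (x : arr a b) (y : arr b c) : x^-1 · (x · y) = y.
Proof. by rewrite gcompA gcompVl gcomp1l. Qed.

Lemma gcompVK (a b c : G) (x : arr b a) (y : arr b c) : x · (x^-1 · y) = y.
Proof. by rewrite gcompA gcompVr gcomp1l. Qed.

Lemma ginv_natl (a b c d : G) (x : arr a b) (y : arr c d)
    (s : arr a c) (t : arr b d) :
  x · t = s · y -> x^-1 · s = t · y^-1.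
Proof.
move=> e; rewrite -[s]gcomp1r -(gcompVr y) (gcompA s) -e -gcompA.
by rewrite gcompKV.
Qed.

Lemma ginv_paste (a b c d a' b' c' d' : G)
    (x : arr a b) (m : arr a c) (y : arr c d)
    (x' : arr a' b') (m' : arr a' c') (y' : arr c' d')
    (p : arr a a') (q : arr b b') (r : arr c c') (s : arr d d') :
  x · q = p · x' -> p · m' = m · r -> y · s = r · y' ->
  x^-1 · m · y · s = q · (x'^-1 · m' · y').
Proof.
move=> ex em ey; rewrite -gcompA ey gcompA -(gcompA _ m) -em !gcompA.
by rewrite (ginv_natl ex).
Qed.

End GroupoidTheory.

Lemma fmapV (K L : groupoid) (h : functor K L) (a b : K) (x : arr a b) :
  fmap h x^-1 = (fmap h x)^-1.
Proof.
by rewrite -[LHS](gcompKV (fmap h x)) -fmapM gcompVr fmap1 gcomp1r.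
Qed.

Section FiberProduct.
Variables (F G H : groupoid) (f : functor F H) (g : functor G H).

Record fp_ob := FpOb {
  fp_l : F;
  fp_r : G;
  fp_x : arr (f fp_l) (g fp_r)
}.

Record fp_arr (p q : fp_ob) := FpArr {
  fpa_l : arr (fp_l p) (fp_l q);
  fpa_r : arr (fp_r p) (fp_r q);
  fpaP : fp_x p · fmap g fpa_r = fmap f fpa_l · fp_x q
}.

Lemma fp_arr_eq p q (s t : fp_arr p q) :
  fpa_l s = fpa_l t -> fpa_r s = fpa_r t -> s = t.
Proof.
case: s t => [sl sr sP] [tl tr tP] /= el er.
by case: tl / el tP; case: tr / er => tP; rewrite (proof_irrelevance _ sP tP).
Qed.

Fact fp_id_subproof p :
  fp_x p · fmap g (gid (fp_r p)) = fmap f (gid (fp_l p)) · fp_x p.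
Proof. by rewrite !fmap1 gcomp1l gcomp1r. Qed.

Definition fp_id p : fp_arr p p := FpArr (fp_id_subproof p).

Fact fp_comp_subproof p q r (s : fp_arr p q) (t : fp_arr q r) :
  fp_x p · fmap g (fpa_r s · fpa_r t) = fmap f (fpa_l s · fpa_l t) · fp_x r.
Proof. by rewrite !fmapM gcompA fpaP -gcompA fpaP gcompA. Qed.

Definition fp_comp p q r (s : fp_arr p q) (t : fp_arr q r) : fp_arr p r :=
  FpArr (fp_comp_subproof s t).

Fact fp_inv_subproof p q (s : fp_arr p q) :
  fp_x q · fmap g (fpa_r s)^-1 = fmap f (fpa_l s)^-1 · fp_x p.
Proof.
by rewrite !fmapV; apply/esym/ginv_natl/esym/fpaP.
Qed.

Definition fp_inv p q (s : fp_arr p q) : fp_arr q p :=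
  FpArr (fp_inv_subproof s).

Fact fp_compA p q r o (s : fp_arr p q) (t : fp_arr q r) (u : fp_arr r o) :
  fp_comp s (fp_comp t u) = fp_comp (fp_comp s t) u.
Proof. by apply: fp_arr_eq; apply: gcompA. Qed.

Fact fp_comp1l p q (s : fp_arr p q) : fp_comp (fp_id p) s = s.
Proof. by apply: fp_arr_eq; apply: gcomp1l. Qed.

Fact fp_comp1r p q (s : fp_arr p q) : fp_comp s (fp_id q) = s.
Proof. by apply: fp_arr_eq; apply: gcomp1r. Qed.

Fact fp_compVl p q (s : fp_arr p q) : fp_comp (fp_inv s) s = fp_id q.
Proof. by apply: fp_arr_eq; apply: gcompVl. Qed.

Fact fp_compVr p q (s : fp_arr p q) : fp_comp s (fp_inv s) = fp_id p.
Proof. by apply: fp_arr_eq; apply: gcompVr. Qed.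

Definition fp : groupoid :=
  Groupoid fp_compA fp_comp1l fp_comp1r fp_compVl fp_compVr.

Definition fp_pi1 : functor fp F :=
  @Functor fp F fp_l fpa_l (fun p => erefl) (fun _ _ _ s t => erefl).

Definition fp_pi2 : functor fp G :=
  @Functor fp G fp_r fpa_r (fun p => erefl) (fun _ _ _ s t => erefl).

Lemma fp_pi1_equivalence : equivalence g -> equivalence fp_pi1.
Proof.
case=> g_surj g_bij; split=> [a | p q].
  have [b [x]] := g_surj (f a).
  by exists (@FpOb a b x^-1); constructor; exact: gid.
have [h hK gK] := g_bij (fp_r p) (fp_r q).
have sP (y : arr (fp_l p) (fp_l q)) :
    fp_x p · fmap g (h ((fp_x p)^-1 · (fmap f y · fp_x q)))
      = fmap f y · fp_x q.
  by rewrite gK gcompVK.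
exists (fun y => FpArr (sP y)) => // s.
by apply: fp_arr_eq => //=; rewrite -fpaP gcompKV hK.
Qed.

End FiberProduct.

Lemma equivalence_comp (G H N : groupoid) (g : functor H N) (f : functor G H) :
  equivalence g -> equivalence f -> equivalence (g ∘ f).
Proof.
move=> [gS gB] [fS fB]; split=> [c | a b]; last first.
  exact: (bij_comp (gB (f a) (f b)) (fB a b)).
have [b [y]] := gS c; have [a [x]] := fS b.
by exists a; constructor; exact: (fmap g x · y).
Qed.

(* The canonical isomorphism, for I --u--> H <--f-- J --v--> N <--g-- K. *)
Section Rebracketing.
Variables (I H J N K : groupoid).
Variables (u : functor I H) (f : functor J H).
Variables (v : functor J N) (g : functor K N).

Let P := fp (v ∘ @fp_pi2 I J H u f) g.
Let Q := fp u (f ∘ @fp_pi1 J K N v g).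

(* ((i, x, j), y, k) |-> (i, x, (j, y, k)) *)
Definition fp_assoc_ob (p : P) : Q :=
  @FpOb I (fp v g) H u (f ∘ fp_pi1 v g) (fp_l (fp_l p))
    (@FpOb J K N v g (fp_r (fp_l p)) (fp_r p) (fp_x p)) (fp_x (fp_l p)).

Definition fp_assoc_map (p q : P) (s : arr p q) :
    arr (fp_assoc_ob p) (fp_assoc_ob q) :=
  @FpArr I (fp v g) H u (f ∘ fp_pi1 v g) (fp_assoc_ob p) (fp_assoc_ob q)
    (fpa_l (fpa_l s))
    (@FpArr J K N v g (fp_r (fp_assoc_ob p)) (fp_r (fp_assoc_ob q))
      (fpa_r (fpa_l s)) (fpa_r s) (fpaP s))
    (fpaP (fpa_l s)).

Fact fp_assoc1 p : fp_assoc_map (gid p) = gid (fp_assoc_ob p).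
Proof. by do 2?apply: fp_arr_eq. Qed.

Fact fp_assocM p q r (s : arr p q) (t : arr q r) :
  fp_assoc_map (s · t) = fp_assoc_map s · fp_assoc_map t.
Proof. by do 2?apply: fp_arr_eq. Qed.

Definition fp_assoc : functor P Q := Functor fp_assoc1 fp_assocM.

(* (i, x, (j, y, k)) |-> ((i, x, j), y, k) *)
Definition fp_unassoc_ob (q : Q) : P :=
  @FpOb (fp u f) K N (v ∘ fp_pi2 u f) g
    (@FpOb I J H u f (fp_l q) (fp_l (fp_r q)) (fp_x q))
    (fp_r (fp_r q)) (fp_x (fp_r q)).

Definition fp_unassoc_map (p q : Q) (s : arr p q) :
    arr (fp_unassoc_ob p) (fp_unassoc_ob q) :=
  @FpArr (fp u f) K N (v ∘ fp_pi2 u f) g (fp_unassoc_ob p) (fp_unassoc_ob q)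
    (@FpArr I J H u f (fp_l (fp_unassoc_ob p)) (fp_l (fp_unassoc_ob q))
      (fpa_l s) (fpa_l (fpa_r s)) (fpaP s))
    (fpa_r (fpa_r s))
    (fpaP (fpa_r s)).

Fact fp_unassoc1 p : fp_unassoc_map (gid p) = gid (fp_unassoc_ob p).
Proof. by do 2?apply: fp_arr_eq. Qed.

Fact fp_unassocM p q r (s : arr p q) (t : arr q r) :
  fp_unassoc_map (s · t) = fp_unassoc_map s · fp_unassoc_map t.
Proof. by do 2?apply: fp_arr_eq. Qed.

Definition fp_unassoc : functor Q P := Functor fp_unassoc1 fp_unassocM.

End Rebracketing.

(* Objects of Mor(G, H): spans G <--psi-- K --u--> H, psi an equivalence. *)
Record mor (G H : groupoid) := Mor {
  mor_K : groupoid;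
  mor_psi : functor mor_K G;
  mor_u : functor mor_K H;
  mor_eqv : equivalence mor_psi
}.

Arguments mor_psi {G H} A : rename.
Arguments mor_u {G H} A : rename.
Arguments mor_eqv {G H} A : rename.

(* The object (k1, z, k2) of K1 x_G K2; z comes last because its type depends
   on k1 and k2. *)
Definition mor_fp_ob (G H : groupoid) (A1 A2 : mor G H)
    (k1 : mor_K A1) (k2 : mor_K A2) (z : arr (mor_psi A1 k1) (mor_psi A2 k2))
    : fp (mor_psi A1) (mor_psi A2) := FpOb z.

Arguments mor_fp_ob {G H} A1 A2 k1 k2 z.

(* Arrows of Mor(G, H). *)
Definition mor_arr (G H : groupoid) (A1 A2 : mor G H) : Type :=
  nat_trans (mor_u A1 ∘ fp_pi1 (mor_psi A1) (mor_psi A2))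
            (mor_u A2 ∘ fp_pi2 (mor_psi A1) (mor_psi A2)).

Definition mor_comp (G H N : groupoid) (B : mor H N) (A : mor G H) : mor G N :=
  @Mor G N (fp (mor_u A) (mor_psi B))
    (mor_psi A ∘ fp_pi1 (mor_u A) (mor_psi B))
    (mor_u B ∘ fp_pi2 (mor_u A) (mor_psi B))
    (equivalence_comp (mor_eqv A) (fp_pi1_equivalence _ (mor_eqv B))).

Section HorizontalComposition.
Variables (G H N : groupoid).
Variables (A1 A2 : mor G H) (B1 B2 : mor H N).
Variables (beta : mor_arr B1 B2) (alpha : mor_arr A1 A2).

Let C1 := mor_comp B1 A1.
Let C2 := mor_comp B2 A2.
Let S := fp (mor_psi C1) (mor_psi C2).

(* Writing an object of S as p = (j1, x, k1, z, k2, y, j2), this is the object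
   (k1, z, k2) at which alpha is evaluated. *)
Definition hcomp_src (p : S) : fp (mor_psi A1) (mor_psi A2) :=
  mor_fp_ob A1 A2 (fp_l (fp_l p)) (fp_l (fp_r p)) (fp_x p).

(* (j1, x^-1 · alpha (k1, z, k2) · y, j2) *)
Definition hcomp_mid (p : S) : fp (mor_psi B1) (mor_psi B2) :=
  mor_fp_ob B1 B2 (fp_r (fp_l p)) (fp_r (fp_r p))
    ((fp_x (fp_l p))^-1 · alpha (hcomp_src p) · fp_x (fp_r p)).

Definition hcomp_ntc (p : S) :
    arr (mor_u B1 (fp_r (fp_l p))) (mor_u B2 (fp_r (fp_r p))) :=
  beta (hcomp_mid p).

Fact hcomp_mid_subproof (p q : S) (s : arr p q) :
  fp_x (hcomp_mid p) · fmap (mor_psi B2) (fpa_r (fpa_r s))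
    = fmap (mor_psi B1) (fpa_r (fpa_l s)) · fp_x (hcomp_mid q).
Proof.
pose t : arr (hcomp_src p) (hcomp_src q) :=
  @FpArr _ _ _ (mor_psi A1) (mor_psi A2) (hcomp_src p) (hcomp_src q)
    (fpa_l (fpa_l s)) (fpa_l (fpa_r s)) (fpaP s).
exact: ginv_paste (fpaP (fpa_l s)) (ntcP alpha t) (fpaP (fpa_r s)).
Qed.

Fact hcompP (p q : S) (s : arr p q) :
  fmap (mor_u C1 ∘ fp_pi1 _ _) s · hcomp_ntc q
    = hcomp_ntc p · fmap (mor_u C2 ∘ fp_pi2 _ _) s.
Proof.
exact: (ntcP beta (@FpArr _ _ _ (mor_psi B1) (mor_psi B2) (hcomp_mid p)
  (hcomp_mid q) _ _ (hcomp_mid_subproof s))).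
Qed.

Definition hcomp : mor_arr (mor_comp B1 A1) (mor_comp B2 A2) :=
  @NatTrans S N (mor_u C1 ∘ fp_pi1 _ _) (mor_u C2 ∘ fp_pi2 _ _)
    hcomp_ntc hcompP.

End HorizontalComposition.

(* Main.v *)
Require Import Defs.
From mathcomp Require Import ssreflect ssrfun ssrbool.
From Stdlib Require Import ProofIrrelevance.
Local Open Scope groupoid_scope.

(** Rebracketing only regroups the entries of a tuple, leaving each entry
as it is.  Each of the four equations between functors therefore
holds on the nose for the actions on objects and on arrows, by the eta rule for
tuples, and two functors with the same actions are equal because their
functoriality laws are propositions ([functor_congr_laws]).

For arrows, take an object (i1, x1, j1, y1, k1) of the source of the first
triple composite, one (i2, x2, j2, y2, k2) of the source of the second, and an
arrow z in G between the images of i1 and i2.  Unfolding the formula for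
horizontal composition, in the order imposed by either bracketing, gives
alpha3 (k1, y1^-1 · alpha2 (j1, x1^-1 · alpha1 (i1, z, i2) · x2, j2) · y2, k2):
both bracketings nest the two translations, by x1 and x2 and by y1 and y2, in
the same way, so the two sides are convertible. *)

(** Reduces an equality of functors whose actions are convertible to proof
irrelevance: in its uses the shared [fob] and [fmap] are found by
conversion. *)
Lemma functor_congr_laws (G H : groupoid) (fob : G -> H)
    (fmap : forall a b : G, arr a b -> arr (fob a) (fob b)) id1 id2 comp1 comp2 :
  @Functor G H fob fmap id1 comp1 = @Functor G H fob fmap id2 comp2.
Proof.
by rewrite (proof_irrelevance _ id1 id2) (proof_irrelevance _ comp1 comp2).
Qed.

Theorem lemma4p4 (G H N M : groupoid) :
  (forall (A : mor G H) (B : mor H N) (C : mor N M),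
    let c := fp_assoc (mor_u A) (mor_psi B) (mor_u B) (mor_psi C) in
    let d := fp_unassoc (mor_u A) (mor_psi B) (mor_u B) (mor_psi C) in
    [/\ d ∘ c = functor_id (mor_K (mor_comp C (mor_comp B A))),
        c ∘ d = functor_id (mor_K (mor_comp (mor_comp C B) A)),
        mor_psi (mor_comp (mor_comp C B) A) ∘ c
          = mor_psi (mor_comp C (mor_comp B A)) &
        mor_u (mor_comp (mor_comp C B) A) ∘ c
          = mor_u (mor_comp C (mor_comp B A))])
  /\
  (forall (A1 A2 : mor G H) (B1 B2 : mor H N) (C1 C2 : mor N M)
      (alpha1 : mor_arr A1 A2) (alpha2 : mor_arr B1 B2)
      (alpha3 : mor_arr C1 C2),
    let c1 := fp_assoc (mor_u A1) (mor_psi B1) (mor_u B1) (mor_psi C1) in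
    let c2 := fp_assoc (mor_u A2) (mor_psi B2) (mor_u B2) (mor_psi C2) in
    forall (p : mor_K (mor_comp C1 (mor_comp B1 A1)))
        (q : mor_K (mor_comp C2 (mor_comp B2 A2)))
        (z : arr (mor_psi (mor_comp C1 (mor_comp B1 A1)) p)
                 (mor_psi (mor_comp C2 (mor_comp B2 A2)) q)),
      hcomp (hcomp alpha3 alpha2) alpha1
        (mor_fp_ob (mor_comp (mor_comp C1 B1) A1)
                   (mor_comp (mor_comp C2 B2) A2) (c1 p) (c2 q) z)
      = hcomp alpha3 (hcomp alpha2 alpha1)
        (mor_fp_ob (mor_comp C1 (mor_comp B1 A1))
                   (mor_comp C2 (mor_comp B2 A2)) p q z)).
Proof.
split=> [A B C c d | A1 A2 B1 B2 C1 C2 alpha1 alpha2 alpha3 c1 c2 p q z].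
  by split; exact: functor_congr_laws.
reflexivity.
Qed.
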